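(* Let $q$ be an odd prime power, let $d\geq 2$ be an integer, let $\mathcal{E}\subseteq\mathbb{F}_q^d$, and let $k\geq2$ be an integer. \begin{itemize} \item If $q\geq5$, $d\geq2$ is even, $r\in\mathbb{F}_q^*$ and $|\mathcal{E}|\geq\left(31+10\binom{k}{2}\right)q^{d/2}$, then $\mathcal{E}$ contains a pair of $k$-stars with dilation ratio $r$. \item If $d\geq3$ is odd, $r\in\mathbb{F}_q^+$ and $|\mathcal{E}|\geq\left(4+\sqrt3\binom{k}{2}\right)q^{d/2}$, then $\mathcal{E}$ contains a pair of $k$-stars with dilation ratio $r$. \end{itemize}
   Context: $\mathbb{F}_q$ is the finite field with $q$ elements, $\mathbb{F}_q^*$ its nonzero elements, and $\mathbb{F}_q^+$ the set of nonzero quadratic residues (nonzero squares) in $\mathbb{F}_q$. For $\bm{x}=(x_1,\ldots,x_d)\in\mathbb{F}_q^d$, $\|\bm{x}\|:=x_1^2+\cdots+x_d^2$. Let $G=(V,E)$ be a graph with $V=\{1,\ldots,n\}$ and $E\subseteq\binom{V}{2}$. A set $\mathcal{E}\subseteq\mathbb{F}_q^d$ contains a pair of $G$ with dilation ratio $r$ if there exist distinct $\bm{x}_1,\ldots,\bm{x}_n\in\mathcal{E}$ and distinct $\bm{y}_1,\ldots,\bm{y}_n\in\mathcal{E}$ such that $\|\bm{y}_i-\bm{y}_j\|=r\|\bm{x}_i-\bm{x}_j\|\neq0$ whenever $\{i,j\}\in E$. A $k$-star is the graph with vertex set $\{1,\ldots,k+1\}$ and edge set $\{\{1,2\},\{1,3\},\ldots,\{1,k+1\}\}$.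 *)

(* Defs.v *)
From HB Require Import structures.
From mathcomp Require Import all_boot all_order all_algebra.
From mathcomp Require Import reals.
Set Implicit Arguments. Unset Strict Implicit. Unset Printing Implicit Defensive.
Import Order.TTheory GRing.Theory Num.Theory.
Local Open Scope ring_scope.

Definition sqnorm (F : finFieldType) (d : nat) (x : 'rV[F]_d) : F :=
  \sum_(i < d) (x 0 i) ^+ 2.

Definition nonzero_square (F : finFieldType) (r : F) : Prop :=
  r != 0 /\ exists s : F, r = s ^+ 2.

(* A graph on vertex set {0,...,n-1} is given by its (symmetric) edge relation.
   E contains a pair of G with dilation ratio r. *)
Definition contains_pair (F : finFieldType) (d n : nat) (edge : rel 'I_n)
    (E : {set 'rV[F]_d}) (r : F) : Prop :=
  exists x y : 'I_n -> 'rV[F]_d,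
    injective x /\ injective y /\
    (forall i, x i \in E /\ y i \in E) /\
    (forall i j, edge i j ->
        sqnorm (y i - y j) = r * sqnorm (x i - x j) /\
        sqnorm (x i - x j) != 0).

(* k-star on vertices {0,...,k} with centre 0 (paper: vertices 1..k+1, centre 1). *)
Definition star_edge (k : nat) : rel 'I_k.+1 :=
  fun i j => (i != j) && ((val i == 0%N) || (val j == 0%N)).
Arguments star_edge k : clear implicits.

(* Main.v *)
Require Import Defs.
From HB Require Import structures.
From mathcomp Require Import all_boot all_order all_algebra.
From mathcomp Require Import all_fingroup all_solvable all_field all_character.
From mathcomp Require Import reals ring lra zify.
Set Implicit Arguments. Unset Strict Implicit. Unset Printing Implicit Defensive.
Import Order.TTheory GRing.Theory Num.Theory.
Local Open Scope ring_scope.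

(** A counting argument reduces stars to single edges.  Put q = |F|, n = |E|, and let M be
    the number of (x, u, y, v) in E^4 with |y - v| = r |x - u| <> 0.  If M >= (3/8) n^4 / q,
    some pair of centres (x, y) is joined to at least (3/8) n^2 / q edge pairs (u, v).
    A sphere has at most 2 q^(d-1) points, so each u and each v occurs in at most that many
    of them, and a greedy choice yields k edge pairs with distinct u's and distinct v's as
    soon as there are more than 4 (k-1) q^(d-1), which the hypothesis on n guarantees.

    To bound M from below, let f(s) be the sum of chi(s |x - u|) over E x E for a
    nontrivial additive character chi.  With the nonnegative spectrum
    A(m) = |sum_(x in E) chi(m . x)|^2 and the Gauss sums G(w) = sum_x chi(w x^2),
    completing the square gives sum_m A(m) chi(w |m|) = G(w)^d f(-1/(4w)) for w <> 0.
    Since (G(w) G(-w/r))^d = q^d when d is even or r is a square, the number Q of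
    quadruples with |y - v| = r |x - u| satisfies
    q^d (q Q - n^4) + (q^d n)^2 >= q P^2, where P is the sum of A(m) over |m| = 0.
    For even d the number of null pairs may be so large that its square is comparable
    with Q, but it is then an affine function of P, and the two squares cancel; for odd d
    it is at most n^2 / q + q^((d-1)/2) n. *)

(** * Characters, squares and row vectors over a finite field *)

Lemma additive_character (F : finFieldType) : exists chi : F -> algC,
  [/\ forall x y, chi (x + y) = chi x * chi y,
      forall x, (chi x)^* = chi (- x), chi 0 = 1 & exists x, chi x != 1].
Proof.
have abF : abelian [set: F] by apply: FinRing.zmod_abelian.
have [i ni0] : exists i : Iirr [set: F], i != 0.
  (* An abelian group has as many irreducible characters as elements, so the additive group of [F]
     has a nontrivial one. *)
  have /card_gt1P[i [j [_ _ ij]]] : (1 < #|Iirr [set: F]|)%N.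
    by rewrite card_Iirr_abelian // cardsT; apply/card_gt1P; exists 0, 1; rewrite eq_sym oner_eq0.
  by have [i0|] := eqVneq i 0; [exists j; rewrite -i0 eq_sym | exists i].
have lin_i : 'chi_i \is a linear_char by apply/char_abelianP.
exists 'chi_i; split=> [x y|x||].
- by rewrite -FinRing.zmodMgE lin_charM ?inE.
- by rewrite -FinRing.zmodVgE lin_charV_conj ?inE.
- by rewrite -FinRing.zmod1gE lin_char1.
- apply/existsP; apply: contraNT ni0; rewrite negb_exists => /forallP chi1.
  rewrite -irr_eq1; apply/eqP/cfunP=> x; rewrite cfun1E inE.
  by apply/eqP/negPn.
Qed.

Lemma finField_odd_2neq0 (F : finFieldType) : odd #|F| -> (2 : F) != 0.
Proof.
move=> oddF; apply/negP => /eqP F2.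
(* By Lagrange, #|F| times 1 is zero; with #|F| odd and 2 = 0 this would give 1 = 0. *)
have := expg_cardG (in_setT (1 : F)); rewrite FinRing.zmodXgE cardsT.
rewrite -(odd_double_half #|F|) oddF -muln2 mulnC mulrnDr mulrnA F2 mul0rn addr0.
by move/eqP; rewrite oner_eq0.
Qed.

Lemma card_sqrt_le2 (F : finFieldType) (a : F) : (#|[set x : F | x ^+ 2 == a]| <= 2)%N.
Proof.
have [x0 /eqP <-|no] := pickP (fun x : F => x ^+ 2 == a); last first.
  by rewrite (eq_card (B := pred0)) ?card0 // => x; rewrite !inE no.
apply: leq_trans (subset_leq_card (B := [set x0; - x0]) _) _; last by rewrite cards2; case: eqP.
by apply/subsetP=> x; rewrite !inE -eqf_sqr.
Qed.

(** Squaring is at most two-to-one, so the squares and their reflections [t - x] each fill more than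
    half of a field of odd size; hence the two sets meet. *)
Lemma sum_two_squares (F : finFieldType) (t : F) :
  odd #|F| -> exists a b : F, t = a ^+ 2 + b ^+ 2.
Proof.
move=> oddF.
pose S := [set x ^+ 2 | x in [set: F]]; pose S' := [set t - x | x in S].
have leS : (#|F| <= #|S| * 2)%N.
  rewrite -[#|F|]cardsT -sum1_card (partition_big_imset (fun x : F => x ^+ 2)) /=.
  rewrite -sum_nat_const; apply: leq_sum => y _.
  apply: leq_trans (card_sqrt_le2 y); rewrite sum1dep_card subset_leq_card //.
  by apply/subsetP=> x; rewrite !inE.
have cS' : #|S'| = #|S| by apply: card_imset => x y /addrI /oppr_inj.
have [|[x]] := set_0Vmem (S :&: S').
  move/eqP; rewrite -cards_eq0 => /eqP SS'0.
  have := cardsUI S S'; rewrite SS'0 addn0 cS' => eqU.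
  have : (#|S :|: S'| <= #|F|)%N by apply: max_card.
  rewrite eqU; move: oddF leS; set s := #|S|; set q := #|F| => ???; exfalso; lia.
rewrite inE => /andP[/imsetP[a _ ->] /imsetP[y /imsetP[b _ ->]]] xy.
by exists a, b; rewrite xy subrK.
Qed.

(** Through this exchange, character sums over row vectors factor into sums over single
    coordinates. *)
Lemma big_row_prod (S : comNzRingType) (F : finType) d (h : 'I_d -> F -> S) :
  \sum_(m : 'rV[F]_d) \prod_(i < d) h i (m 0 i) = \prod_(i < d) \sum_x h i x.
Proof.
rewrite bigA_distr_bigA (reindex (fun f : {ffun 'I_d -> F} => \row_i f i)) /=; last first.
  exists (fun m : 'rV[F]_d => [ffun i => m 0 i]) => [f|m] _.
    by apply/ffunP=> i; rewrite ffunE mxE.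
  by apply/rowP=> i; rewrite mxE ffunE.
by apply: eq_bigr => f _; apply: eq_bigr => i _; rewrite mxE.
Qed.

Definition dotp (F : finFieldType) d (m z : 'rV[F]_d) : F := \sum_(i < d) m 0 i * z 0 i.

Lemma dotpB (F : finFieldType) d (m x y : 'rV[F]_d) : dotp m (x - y) = dotp m x - dotp m y.
Proof. by rewrite -sumrB; apply: eq_bigr => i _; rewrite !mxE mulrBr. Qed.

Definition sqdist (F : finFieldType) d (p : 'rV[F]_d * 'rV[F]_d) : F := sqnorm (p.1 - p.2).

Definition null_pairs (F : finFieldType) d (E : {set 'rV[F]_d}) :=
  [set p in setX E E | sqdist p == 0].

(** Null distances are included because the character expansion counts every solution of the
    equation; [card_dilated_pairs_split] separates them later. *)
Definition dilated_pairs (F : finFieldType) d (E : {set 'rV[F]_d}) (r : F) :=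
  [set w in setX (setX E E) (setX E E) | sqdist w.2 == r * sqdist w.1].

(** * Orthogonality and quadratic Gauss sums *)

Section Fourier.

Variables (F : finFieldType) (chi : F -> algC).
Hypothesis oddF : odd #|F|.
Hypothesis chiD : forall x y, chi (x + y) = chi x * chi y.
Hypothesis chi_conj : forall x, (chi x)^* = chi (- x).
Hypothesis chi0 : chi 0 = 1.
Hypothesis chi_neq1 : exists x, chi x != 1.

Local Notation q := (#|F|%:R : algC).

Lemma chi_sum : \sum_s chi s = 0.
Proof.
have [x chix] := chi_neq1.
have : (1 - chi x) * \sum_s chi s = 0.
  rewrite mulrBl mul1r mulr_sumr (reindex_inj (addrI x)) /=.
  by rewrite (eq_bigr (fun s => chi x * chi s)) ?subrr // => s _; rewrite chiD.
by move/eqP; rewrite mulf_eq0 subr_eq0 eq_sym (negPf chix) => /eqP.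
Qed.

Lemma chi_orth t : \sum_s chi (s * t) = q * (t == 0)%:R.
Proof.
have [->|t0] := eqVneq t 0.
  by rewrite (eq_bigr (fun=> 1)) => [|s _]; rewrite ?mulr0 // sumr_const mulr1.
by rewrite mulr0; apply: etrans chi_sum; rewrite [RHS](reindex_inj (mulIf t0)).
Qed.

Lemma chi_prod I (s : seq I) (P : pred I) (a : I -> F) :
  chi (\sum_(i <- s | P i) a i) = \prod_(i <- s | P i) chi (a i).
Proof. exact: (big_morph chi chiD chi0). Qed.

Lemma count_zeros (I : finType) (P : {set I}) (D : I -> F) :
  q * #|[set p in P | D p == 0]|%:R = \sum_s \sum_(p in P) chi (s * D p).
Proof.
rewrite exchange_big /= (eq_bigr _ (fun p _ => chi_orth (D p))) -mulr_sumr.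
rewrite -sum1dep_card natr_sum big_mkcondr; congr (_ * _).
by apply: eq_bigr => p _; case: eqP.
Qed.

Definition gauss s := \sum_x chi (s * x ^+ 2).

(** Writing x = y + z turns the exponent s (x^2 - y^2) into s z^2 + 2 s z y, and the sum over y then
    kills every z except 0. *)
Lemma gaussN s : s != 0 -> gauss s * gauss (- s) = q.
Proof.
move=> s0; rewrite mulrC mulr_suml.
under eq_bigr => y _ do rewrite mulr_sumr (reindex_inj (addrI y)) /=.
rewrite exchange_big /= (eq_bigr (fun z => chi (s * z ^+ 2) * (q * (z == 0)%:R))); last first.
  move=> z _; have <- : (2 * s * z == 0) = (z == 0).
    by rewrite !mulf_eq0 (negPf s0) (negPf (finField_odd_2neq0 oddF)).
  rewrite -chi_orth mulr_sumr; apply: eq_bigr => y _.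
  by rewrite -!chiD; congr chi; ring.
rewrite (bigD1 0) //= [X in _ + X]big1 => [|z /negPf->]; last by rewrite !mulr0.
by rewrite eqxx mulr1 expr0n mulr0 chi0 mul1r addr0.
Qed.

Lemma gaussM s u : u != 0 -> gauss (s * u ^+ 2) = gauss s.
Proof.
move=> u0; rewrite /gauss [RHS](reindex_inj (mulfI u0)) /=.
by apply: eq_bigr => x _; congr chi; ring.
Qed.

(* Multiplication by a + ib maps the norm form x^2 + y^2 to its multiple by s = a^2 + b^2. *)
Lemma gauss_sqr s : s != 0 -> gauss s ^+ 2 = gauss 1 ^+ 2.
Proof.
move=> s0; have [a [b sE]] := sum_two_squares s oddF.
have sqrE t : gauss t ^+ 2 = \sum_(p : F * F) chi (t * (p.1 ^+ 2 + p.2 ^+ 2)).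
  rewrite expr2 big_distrlr pair_big /=; apply: eq_bigr => p _.
  by rewrite -chiD mulrDr.
have inj : injective (fun p : F * F => (a * p.1 - b * p.2, b * p.1 + a * p.2)).
  move=> [x y] [x' y'] /= [e1 e2]; congr pair; apply: (mulfI s0); rewrite sE.
    have -> : (a ^+ 2 + b ^+ 2) * x = a * (a * x - b * y) + b * (b * x + a * y) by ring.
    by rewrite e1 e2; ring.
  have -> : (a ^+ 2 + b ^+ 2) * y = a * (b * x + a * y) - b * (a * x - b * y) by ring.
  by rewrite e1 e2; ring.
rewrite !sqrE [RHS](reindex_inj inj) /=; apply: eq_bigr => p _.
by rewrite sE; congr chi; ring.
Qed.

Lemma gauss_shift w z : w != 0 ->
  \sum_m chi (w * m ^+ 2 + m * z) = chi (- z ^+ 2 / (4 * w)) * gauss w.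
Proof.
move=> w0; have n2 := finField_odd_2neq0 oddF.
have n4 : (4 : F) != 0 by rewrite (_ : 4 = 2 * 2) ?mulf_neq0 // -natrM.
rewrite (reindex_inj (addrI (- z / (2 * w)))) mulr_sumr /=.
apply: eq_bigr => m _; rewrite -chiD; congr chi.
by field; rewrite w0 n2 n4.
Qed.

Variable d : nat.

Lemma gauss_row w (z : 'rV[F]_d) : w != 0 ->
  \sum_m chi (w * sqnorm m + dotp m z) = chi (- sqnorm z / (4 * w)) * gauss w ^+ d.
Proof.
move=> w0.
rewrite (eq_bigr (fun m : 'rV[F]_d => \prod_(i < d) chi (w * m 0 i ^+ 2 + m 0 i * z 0 i))).
  rewrite (big_row_prod (fun i x => chi (w * x ^+ 2 + x * z 0 i))).
  rewrite (eq_bigr _ (fun i _ => gauss_shift (z 0 i) w0)) big_split /= -chi_prod.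
  by rewrite prodr_const card_ord -mulr_suml -sumrN.
by move=> m _; rewrite -chi_prod big_split /= -mulr_sumr.
Qed.

Lemma chi_orth_row (z : 'rV[F]_d) : \sum_m chi (dotp m z) = q ^+ d * (z == 0)%:R.
Proof.
rewrite (eq_bigr (fun m : 'rV[F]_d => \prod_(i < d) chi (m 0 i * z 0 i))).
  rewrite (big_row_prod (fun i x => chi (x * z 0 i))).
  rewrite (eq_bigr _ (fun i _ => chi_orth (z 0 i))) big_split /= prodr_const card_ord.
  congr (_ * _); have [->|z0] := eqVneq z 0.
    by rewrite big1 // => i _; rewrite mxE eqxx.
  have /rV0Pn[i zi] := z0.
  by rewrite (bigD1 i) //= (negPf zi) mul0r.
by move=> m _; rewrite -chi_prod.
Qed.

(** * The Fourier spectrum of a point set *)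

Variable E : {set 'rV[F]_d}.
Local Notation n := (#|E|%:R : algC).

(** In the notation of the overview, [dist_sum] is f, [spectrum] is A, and [null_spectrum] below is
    P. *)
Definition dist_sum s := \sum_(p in setX E E) chi (s * sqdist p).
Definition spectrum m := `|\sum_(x in E) chi (dotp m x)| ^+ 2.
Definition spectrum_sum w := \sum_m spectrum m * chi (w * sqnorm m).

Lemma spectrum_ge0 m : 0 <= spectrum m. Proof. by rewrite exprn_ge0. Qed.

Lemma spectrumE m : spectrum m = \sum_(p in setX E E) chi (dotp m (p.1 - p.2)).
Proof.
rewrite /spectrum normCK rmorph_sum big_distrlr pair_big /=.
by apply: eq_big => p; rewrite ?inE // => _; rewrite chi_conj -chiD dotpB.
Qed.

(** Parseval: orthogonality over all m leaves only the diagonal pairs of [E]. *)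
Lemma sum_spectrum : \sum_m spectrum m = q ^+ d * n.
Proof.
rewrite (eq_bigr _ (fun m _ => spectrumE m)) exchange_big /=.
rewrite (eq_bigr _ (fun p _ => chi_orth_row (p.1 - p.2))) -mulr_sumr; congr (_ * _).
rewrite (eq_bigl (fun p => (p.1 \in E) && (p.2 \in E))); last by move=> p; rewrite inE.
rewrite -(pair_big _ _ (fun x u => (x - u == 0)%:R)) /= -[n]sumr_const.
apply: eq_bigr => x xE; rewrite (bigD1 x) //= subrr eqxx big1 ?addr0 // => u /andP[_ ux].
by rewrite subr_eq0 eq_sym (negPf ux).
Qed.

Lemma spectrum_sumE w : w != 0 ->
  spectrum_sum w = gauss w ^+ d * dist_sum (- (4 * w)^-1).
Proof.
move=> w0; rewrite /spectrum_sum.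
under eq_bigr => m _ do rewrite spectrumE mulr_suml.
rewrite exchange_big mulr_sumr /=; apply: eq_bigr => p _.
rewrite mulrC (_ : - _ * _ = - sqdist p / (4 * w)); last by ring.
rewrite -gauss_row //; apply: eq_bigr => m _.
by rewrite -chiD addrC.
Qed.

Lemma spectrum_sum0 : spectrum_sum 0 = q ^+ d * n.
Proof.
by rewrite -sum_spectrum; apply: eq_bigr => m _; rewrite mul0r chi0 mulr1.
Qed.

Lemma dist_sum0 : dist_sum 0 = n ^+ 2.
Proof.
rewrite /dist_sum (eq_bigr (fun=> 1)) => [|p _]; last by rewrite mul0r chi0.
by rewrite sumr_const cardsX natrM expr2.
Qed.

(** This reindexing moves sums of [dist_sum] to the arguments at which [spectrum_sumE] evaluates it.
    Since the inverse of 0 is 0, the substitution is an involution of all of [F] that fixes 0. *)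
Lemma sum_split_inv (f : F -> algC) :
  \sum_s f s = f 0 + \sum_(w | w != 0) f (- (4 * w)^-1).
Proof.
have n4 : (4 : F) != 0.
  by rewrite (_ : 4 = 2 * 2) ?mulf_neq0 ?finField_odd_2neq0 // -natrM.
have inv : involutive (fun w : F => - (4 * w)^-1).
  move=> w; have [->|w0] := eqVneq w 0; first by rewrite !(mulr0, invr0, oppr0).
  by field; rewrite w0 n4 oppr_eq0 oner_eq0.
rewrite (reindex_inj (inv_inj inv)) (bigD1 0) //=.
by rewrite mulr0 invr0 oppr0.
Qed.

Definition null_spectrum := \sum_(m | sqnorm m == 0) spectrum m.

Lemma null_spectrum_ge0 : 0 <= null_spectrum.
Proof. by apply: sumr_ge0 => m _; apply: spectrum_ge0. Qed.

Lemma null_spectrum_le : null_spectrum <= q ^+ d * n.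
Proof.
rewrite -sum_spectrum (bigID (fun m : 'rV[F]_d => sqnorm m == 0) predT) /= lerDl.
by apply: sumr_ge0 => m _; apply: spectrum_ge0.
Qed.

Lemma card_dilated_pairs r :
  q * #|dilated_pairs E r|%:R = \sum_s dist_sum s * dist_sum (- (r * s)).
Proof.
have -> : dilated_pairs E r =
    [set w in setX (setX E E) (setX E E) | sqdist w.2 - r * sqdist w.1 == 0].
  by apply/setP=> w; rewrite !inE subr_eq0.
rewrite count_zeros; apply: eq_bigr => s _.
rewrite mulrC big_distrlr pair_big /=; apply: eq_big => w; first by rewrite [in LHS]inE.
by rewrite inE => _; rewrite -chiD; congr chi; ring.
Qed.

(** The term s = 0 in the expansion of [card_dilated_pairs] is n^4. The other terms become products
    [spectrum_sum w * spectrum_sum (- (w / r))] with w nonzero, and (q^d n)^2 supplies the product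
    at w = 0. Orthogonality in w leaves a nonnegative sum over |m| = |m'| / r, of which only the
    part |m| = |m'| = 0 is kept. *)
Lemma null_spectrum_sqr_le r :
    r != 0 -> (forall w, w != 0 -> (gauss w * gauss (- (w / r))) ^+ d = q ^+ d) ->
  q * null_spectrum ^+ 2 <= q ^+ d * (q * #|dilated_pairs E r|%:R - n ^+ 4) + (q ^+ d * n) ^+ 2.
Proof.
move=> r0 Hr.
rewrite card_dilated_pairs sum_split_inv mulr0 oppr0 dist_sum0 -exprD addrAC subrr add0r.
have -> : q ^+ d * (\sum_(w | w != 0) dist_sum (- (4 * w)^-1) * dist_sum (- (r * - (4 * w)^-1)))
    + (q ^+ d * n) ^+ 2 = \sum_w spectrum_sum w * spectrum_sum (- (w / r)).
  rewrite [RHS](bigD1 0) //= mul0r oppr0 spectrum_sum0 -expr2 addrC mulr_sumr; congr (_ + _).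
  apply: eq_bigr => w w0; have w'0 : - (w / r) != 0 by rewrite oppr_eq0 mulf_neq0 ?invr_eq0.
  rewrite !spectrum_sumE // mulrACA -exprMn Hr //; congr (_ * (_ * dist_sum _)).
  by rewrite mulrN opprK mulrN invrN opprK !invfM invrK; ring.
have -> : \sum_w spectrum_sum w * spectrum_sum (- (w / r)) =
    \sum_m \sum_m' spectrum m * spectrum m' * (q * (sqnorm m - sqnorm m' / r == 0)%:R).
  under eq_bigr => w _ do rewrite big_distrlr /=.
  rewrite exchange_big /=; apply: eq_bigr => m _.
  rewrite exchange_big /=; apply: eq_bigr => m' _.
  rewrite -chi_orth mulr_sumr; apply: eq_bigr => w _.
  by rewrite mulrACA -chiD; congr (_ * chi _); ring.
have ge0 m m' : 0 <= spectrum m * spectrum m' * (q * (sqnorm m - sqnorm m' / r == 0)%:R).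
  by rewrite !mulr_ge0 ?spectrum_ge0 // ler0n.
rewrite [leRHS](bigID (fun m : 'rV[F]_d => sqnorm m == 0)) /=.
rewrite -[leLHS]addr0; apply: lerD; last by do 2![apply: sumr_ge0 => *].
rewrite expr2 big_distrlr mulr_sumr; apply: ler_sum => m /eqP m0.
rewrite [leRHS](bigID (fun m : 'rV[F]_d => sqnorm m == 0)) /=.
rewrite -[leLHS]addr0; apply: lerD; last by apply: sumr_ge0.
rewrite mulr_sumr; apply: ler_sum => m' /eqP m'0.
by rewrite m0 m'0 mul0r subr0 eqxx mulr1 mulrC.
Qed.

(** By [gauss_sqr] the squares at w and -w agree, so the fourth power is the square of the product
    in [gaussN]. *)
Lemma gauss_sqr_sqr w : w != 0 -> (gauss w ^+ 2) ^+ 2 = q ^+ 2.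
Proof.
move=> w0; rewrite -(gaussN w0) [RHS]exprMn (gauss_sqr (s := - w)) ?oppr_eq0 //.
by rewrite -(gauss_sqr w0) -expr2.
Qed.

(** In even dimension only squares of Gauss sums occur, and these do not depend on the argument. *)
Lemma gauss_prod_even r w : ~~ odd d -> r != 0 -> w != 0 ->
  (gauss w * gauss (- (w / r))) ^+ d = q ^+ d.
Proof.
move=> even_d r0 w0; rewrite -(even_halfK even_d) -mul2n !exprM (exprMn 2 (gauss w)).
have w'0 : - (w / r) != 0 by rewrite oppr_eq0 mulf_neq0 ?invr_eq0.
by rewrite (gauss_sqr w'0) -(gauss_sqr w0) -expr2 gauss_sqr_sqr.
Qed.

(** A square factor in the argument is absorbed by [gaussM], which reduces the product to
    [gaussN]. *)
Lemma gauss_prod_square r w : nonzero_square r -> w != 0 ->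
  (gauss w * gauss (- (w / r))) ^+ d = q ^+ d.
Proof.
move=> [r0 [s rE]] w0; have s0 : s != 0 by apply: contra_neq r0; rewrite rE => ->; rewrite expr0n.
by rewrite rE -exprVn -mulNr gaussM ?invr_eq0 // gaussN.
Qed.

(** The sum of [spectrum_sum] over all w is q P. For w nonzero, [gauss w ^+ d] is a constant,
    q^(d/2) up to the sign recorded by [b], so these terms give that constant times the expansion of
    q nu - n^2, where nu counts the null pairs. *)
Lemma null_pairs_even : ~~ odd d -> exists b : bool,
  q * null_spectrum = (-1) ^+ b * (q ^+ d./2 * (q * #|null_pairs E|%:R - n ^+ 2)) + q ^+ d * n.
Proof.
move=> even_d; have [b bE] : exists b : bool, gauss 1 ^+ 2 = (-1) ^+ b * q.
  have := gauss_sqr_sqr (oner_neq0 F) => /eqP; rewrite eqf_sqr => /orP[]/eqP->.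
    by exists false; rewrite mul1r.
  by exists true; rewrite expr1 mulN1r.
have sq w : w != 0 -> gauss w ^+ d = (-1) ^+ (b && odd d./2) * q ^+ d./2.
  move=> w0; rewrite -(even_halfK even_d) -mul2n exprM gauss_sqr // bE exprMn mul2n doubleK.
  by case: (b); rewrite /= ?expr1 ?signr_odd ?expr0 ?expr1n.
exists (b && odd d./2); rewrite count_zeros sum_split_inv -/(dist_sum 0) dist_sum0.
rewrite addrAC subrr add0r.
have -> : q * null_spectrum = \sum_w spectrum_sum w.
  rewrite exchange_big /= (eq_bigr (fun m => q * (spectrum m * (sqnorm m == 0)%:R))) => [|m _].
    rewrite -mulr_sumr /null_spectrum big_mkcond; congr (_ * _); apply: eq_bigr => m _.
    by case: eqP; rewrite ?mulr1 ?mulr0.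
  by rewrite -mulr_sumr chi_orth mulrCA.
rewrite (bigD1 0) //= spectrum_sum0 addrC !mulr_sumr; congr (_ + _); apply: eq_bigr => w w0.
by rewrite spectrum_sumE // sq // mulrA.
Qed.

(** Here [gauss w ^+ d] still depends on w through one factor [gauss w]. Multiplying by
    [gauss (- w)] turns that factor into q, at the price of weighting each frequency m by the number
    of square roots of |m|. *)
Lemma null_pairs_odd : odd d -> q * #|null_pairs E|%:R <= n ^+ 2 + q ^+ (d./2).+1 * n.
Proof.
move=> odd_d; set h := q ^+ d./2.
have q0 : 0 < q by rewrite ltr0n; apply/card_gt0P; exists 0.
have h0 : 0 < h by apply: exprn_gt0.
have dE : d = (d./2.*2).+1 by rewrite -[LHS]odd_double_half odd_d.
(* [c] is the sign of the even power [gauss 1 ^+ (d - 1)]. *)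
have [c [cE cr]] : exists c, gauss 1 ^+ (d./2.*2) = c * h /\ (c = 1 \/ c = -1).
  exists (gauss 1 ^+ (d./2.*2) / h); split; first by rewrite divfK // gt_eqF.
  have := gauss_sqr_sqr (oner_neq0 F) => /eqP; rewrite eqf_sqr => /orP[]/eqP sE.
    by left; rewrite -mul2n exprM sE divff // gt_eqF.
  rewrite -mul2n exprM sE exprNn mulfK ?gt_eqF //.
  by rewrite -signr_odd; case: (odd _); [right|left].
have c2 : c * c = 1 by case: cr => ->; rewrite ?mulrNN mulr1.
have key : c * h * q * (q * #|null_pairs E|%:R - n ^+ 2) =
    \sum_m spectrum m * (q * #|[set x : F | x ^+ 2 == sqnorm m]|%:R - q).
  rewrite count_zeros sum_split_inv -/(dist_sum 0) dist_sum0 addrAC subrr add0r.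
  rewrite mulr_sumr (eq_bigr (fun w => spectrum_sum w * gauss (- w))) => [|w w0]; last first.
    rewrite spectrum_sumE // [in gauss w ^+ d]dE exprS -mul2n exprM gauss_sqr // -exprM mul2n cE.
    by rewrite -(gaussN w0) -/(dist_sum _); ring.
  have -> : \sum_(w | w != 0) spectrum_sum w * gauss (- w) =
     \sum_w spectrum_sum w * gauss (- w) - q * \sum_m spectrum m.
    rewrite [in RHS](bigD1 0) //= oppr0 spectrum_sum0 sum_spectrum.
    have -> : gauss 0 = q.
      by rewrite /gauss (eq_bigr (fun=> 1)) => [|x _]; rewrite ?mul0r // sumr_const.
    by ring.
  rewrite mulr_sumr; under eq_bigr => w _ do rewrite mulr_suml.
  rewrite exchange_big -sumrB /=; apply: eq_bigr => m _.
  rewrite mulrBr [q * spectrum m]mulrC; congr (_ - _).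
  have -> : [set x : F | x ^+ 2 == sqnorm m] = [set x in [set: F] | sqnorm m - x ^+ 2 == 0].
    by apply/setP=> x; rewrite !inE subr_eq0 eq_sym.
  rewrite count_zeros mulr_sumr; apply: eq_bigr => w _.
  rewrite -mulrA; congr (_ * _); rewrite mulr_sumr; apply: eq_big => x; rewrite ?inE // => _.
  by rewrite -chiD; congr chi; ring.
(* With 0, 1 or 2 square roots the weight is -q, 0 or q, so Parseval bounds the sum whichever the
   sign. *)
have bound (t : algC) : t = 1 \/ t = -1 ->
    t * \sum_m spectrum m * (q * #|[set x : F | x ^+ 2 == sqnorm m]|%:R - q) <= q * (q ^+ d * n).
  move=> tE; rewrite -sum_spectrum !mulr_sumr; apply: ler_sum => m _.
  rewrite mulrCA [leRHS]mulrC ler_wpM2l ?spectrum_ge0 //.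
  have := card_sqrt_le2 (sqnorm m); case: #|_| => [|[|[|//]]] _; case: tE => ->;
    rewrite ?mulr0 ?mulr1 ?mul1r ?mulN1r ?subrr ?sub0r ?opprK ?oppr0 ?(ltW q0) //.
  - by rewrite lerNl (le_trans _ (ltW q0)) // oppr_le0 ltW.
  - by rewrite mulr_natr mulr2n addrK.
  - by rewrite mulr_natr mulr2n addrK lerNl (le_trans _ (ltW q0)) // oppr_le0 ltW.
have := bound c cr; rewrite -key !mulrA c2 mul1r -!mulrA mulrCA ler_pM2l //.
rewrite (_ : q ^+ d * n = h * (q ^+ d./2.+1 * n)); last first.
  by rewrite /h mulrA -exprD addnS addnn -dE.
by rewrite ler_pM2l // lerBlDl.
Qed.

End Fourier.

(** * Integer inequalities that isolate the non-null quadruples *)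

Lemma even_dilated_bound (q h n nu Q Z : int) (b : bool) :
  5 <= q -> 0 <= h -> 41 * h <= n ->
  Z = (-1) ^+ b * (q * nu - n ^+ 2) + h * n -> 0 <= Z -> Z <= q * h * n ->
  q * n ^+ 4 + Z ^+ 2 - q * h ^+ 2 * n ^+ 2 <= q ^+ 2 * Q ->
  3 * q * n ^+ 4 <= 8 * q ^+ 2 * (Q - nu ^+ 2).
Proof.
move=> q5 h0 hn ZE Z0 Zle QE; have n0 : 0 <= n by lra.
(* Since q nu = n^2 + y with y equal to Z - h n up to sign, subtracting (q nu)^2 cancels Z^2. What
   remains is controlled by |Z - h n| <= q h n. *)
have step : (q - 1) * n ^+ 4 - 2 * q * (h * n ^+ 3) - (q + 1) * (h ^+ 2 * n ^+ 2)
    <= q ^+ 2 * (Q - nu ^+ 2).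
  have Zhn : 0 <= Z * (h * n) by rewrite !mulr_ge0.
  have hn0 : 0 <= h * n by rewrite mulr_ge0.
  have qhn : h * n <= q * h * n by rewrite -mulrA ler_peMl ?mulr_ge0 //; lra.
  have n2 : 0 <= n ^+ 2 by rewrite exprn_ge0.
  have nuE : (q * nu) ^+ 2 = (n ^+ 2 + (-1) ^+ b * (Z - h * n)) ^+ 2.
    by rewrite ZE; case: (b) => /=; ring.
  have lb : - (q * h * n) * n ^+ 2 <= - ((-1) ^+ b * (Z - h * n)) * n ^+ 2.
    by apply: ler_wpM2r => //; case: (b); rewrite ?expr0 ?expr1 ?mulN1r ?mul1r; lra.
  have sgn2 : ((-1) ^+ b * (Z - h * n)) ^+ 2 = (Z - h * n) ^+ 2 by case: (b); ring.
  set y := (-1) ^+ b * _ in nuE lb sgn2.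
  have -> : q ^+ 2 * (Q - nu ^+ 2) = q ^+ 2 * Q - (q * nu) ^+ 2 by ring.
  rewrite nuE sqrrD sgn2; lra.
have hn3 : 41 * (h * n ^+ 3) <= n ^+ 4.
  by rewrite mulrA [leRHS]exprS ler_wpM2r ?exprn_ge0.
have h2n2 : 41 * (h ^+ 2 * n ^+ 2) <= h * n ^+ 3.
  rewrite (_ : _ * _ = h * (41 * h * n ^+ 2)); last by ring.
  by apply: ler_wpM2l => //; rewrite [leRHS]exprS ler_wpM2r ?exprn_ge0.
have n4 : 0 <= n ^+ 4 by rewrite exprn_ge0.
have B0 : 0 <= h ^+ 2 * n ^+ 2 by rewrite mulr_ge0 ?exprn_ge0.
set A := n ^+ 4 in step hn3 n4 *; set B := h * n ^+ 3 in step hn3 h2n2 *.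
set C := h ^+ 2 * n ^+ 2 in step h2n2 B0 *; set M := q ^+ 2 * _ in step *.
have -> : 8 * q ^+ 2 * (Q - nu ^+ 2) = 8 * M by rewrite /M mulrA.
have q0 : 0 <= q - 5 by lra.
have {}hn3 : 0 <= A - 41 * B by lra.
have {}h2n2 : 0 <= B - 41 * C by lra.
(* Multiplying the gaps by q - 5 supplies every product with q that the final linear combination
   uses. *)
have := mulr_ge0 q0 hn3; have := mulr_ge0 q0 h2n2; have := mulr_ge0 q0 n4; have := mulr_ge0 q0 B0.
clearbody A B C M; clear -step n4 B0 hn3 h2n2 q0; lra.
Qed.

Lemma odd_dilated_bound (q h n nu Q : int) :
  3 <= q -> 0 <= h -> 0 <= n -> 0 <= nu -> 32 * (q * h ^+ 2) <= n ^+ 2 ->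
  q * nu <= n ^+ 2 + q * h * n -> n ^+ 4 <= q * Q + q * h ^+ 2 * n ^+ 2 ->
  3 * q * n ^+ 4 <= 8 * q ^+ 2 * (Q - nu ^+ 2).
Proof.
move=> q3 h0 n0 nu0 qh nule QE.
have nu2 : (q * nu) ^+ 2 <= (n ^+ 2 + q * h * n) ^+ 2.
  by rewrite ler_sqr ?nnegrE ?addr_ge0 ?mulr_ge0 ?exprn_ge0 //; lra.
(* These weights fit exactly: the loss is 4 (q h n)^2 + (3/2) n^4, at most q n^4 / 8 + q n^4 / 2,
   which leaves 3/8 of q n^4. *)
have amgm : 2 * (n ^+ 2 + q * h * n) ^+ 2 <= 3 * n ^+ 4 + 6 * (q * h * n) ^+ 2.
  by have := sqr_ge0 (n ^+ 2 - 2 * (q * h * n)); lra.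
have q0 : 0 <= q by lra.
have qQ := ler_wpM2l q0 QE.
have C1 : 32 * (q * h * n) ^+ 2 <= q * n ^+ 4.
  rewrite (_ : _ * _ = (q * n ^+ 2) * (32 * (q * h ^+ 2))); last by ring.
  rewrite (_ : q * n ^+ 4 = (q * n ^+ 2) * n ^+ 2); last by ring.
  by apply: ler_wpM2l => //; rewrite mulr_ge0 ?exprn_ge0.
have A1 : 3 * n ^+ 4 <= q * n ^+ 4 by rewrite ler_wpM2r ?exprn_ge0.
lra.
Qed.

Lemma pred_leq_bin2 k : (2 <= k)%N -> (k.-1 <= 'C(k, 2))%N.
Proof. by case: k => [|[|k]] // _; rewrite binS bin1 leq_addl. Qed.

(** * Lower bounds for the number of non-null quadruples *)

Definition nonnull_dilated_pairs (F : finFieldType) d (E : {set 'rV[F]_d}) (r : F) :=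
  [set w in dilated_pairs E r | sqdist w.1 != 0].

(** If the first distance is null, so is the second; the null part is therefore a full product of
    [null_pairs] with itself. *)
Lemma card_dilated_pairs_split (F : finFieldType) d (E : {set 'rV[F]_d}) (r : F) : r != 0 ->
  #|dilated_pairs E r| = (#|null_pairs E| ^ 2 + #|nonnull_dilated_pairs E r|)%N.
Proof.
move=> r0; rewrite -mulnn -cardsX -(cardsID (setX (null_pairs E) (null_pairs E))).
congr (_ + _)%N; apply: eq_card => w; rewrite !inE.
  have [w1|] := eqVneq (sqdist w.1) 0; last by rewrite andbF /= !andbF.
  rewrite w1 mulr0; case: (w.1.1 \in E); case: (w.1.2 \in E); case: (w.2.1 \in E);
    by case: (w.2.2 \in E) => //=; case: eqP.
have [->|w1] := eqVneq (sqdist w.1) 0; last by rewrite andbF /= andbT.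
rewrite mulr0; case: (w.1.1 \in E); case: (w.1.2 \in E); case: (w.2.1 \in E);
  by case: (w.2.2 \in E) => //=; case: eqP.
Qed.

Lemma card_finField_gt0 (F : finFieldType) : (0 < #|F|)%N.
Proof. by apply/card_gt0P; exists 0. Qed.

Lemma natz_dilated_bound (q n nu M : nat) :
  3 * q%:Z * n%:Z ^+ 4 <= 8 * q%:Z ^+ 2 * ((nu ^ 2 + M)%N%:Z - nu%:Z ^+ 2) ->
  (3 * q * n ^ 4 <= 8 * q ^ 2 * M)%N.
Proof.
by rewrite -!natz natrD natrX addrC addKr -!natrX -!natrM ler_nat.
Qed.

Lemma even_nonnull_dilated_pairs (F : finFieldType) d (E : {set 'rV[F]_d}) (r : F) :
  odd #|F| -> ~~ odd d -> r != 0 -> (5 <= #|F|)%N -> (41 * #|F| ^ d./2 <= #|E|)%N ->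
  (3 * #|F| * #|E| ^ 4 <= 8 * #|F| ^ 2 * #|nonnull_dilated_pairs E r|)%N.
Proof.
move=> oddF even_d r0 q5 En.
have [chi [chiD chi_conj chi0 chi1]] := additive_character F.
have [b bE] := null_pairs_even oddF chiD chi_conj chi0 chi1 E even_d.
have gE w := gauss_prod_even oddF chiD chi0 chi1 even_d r0 (w := w).
have := null_spectrum_sqr_le oddF chiD chi_conj chi0 chi1 E r0 gE.
have N0 := null_spectrum_ge0 chi E.
have N1 := null_spectrum_le chiD chi_conj chi0 chi1 E.
move: bE N0 N1; set N := null_spectrum _ _ => bE N0 N1 NQ.
pose q : int := #|F|%:Z; pose h : int := #|F|%:Z ^+ d./2; pose n : int := #|E|%:Z.
pose nu : int := #|null_pairs E|%:Z; pose Q : int := #|dilated_pairs E r|%:Z.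
(* By [null_pairs_even], [Z] is q P / h, so the bounds on P become bounds on an integer. *)
pose Z := (-1) ^+ b * (q * nu - n ^+ 2) + h * n.
have qh : q ^+ d = h ^+ 2 by rewrite /h -exprM muln2 even_halfK.
have q0 : 0 < q by rewrite ltz_nat card_finField_gt0.
have h0 : 0 < h by rewrite exprn_gt0.
have hn : 41 * h <= n by rewrite /h /n -!natz -natrX -natrM ler_nat.
have qhC : #|F|%:R ^+ d = h%:~R ^+ 2 :> algC.
  by have := congr1 (intr : int -> algC) qh; rewrite !rmorphXn.
have heC : h%:~R = #|F|%:R ^+ d./2 :> algC by rewrite rmorphXn.
clearbody h; rewrite -heC in bE.
have castE (x : nat) : (x%:Z)%:~R = x%:R :> algC by [].
have NE : #|F|%:R * N = h%:~R * Z%:~R.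
  rewrite bE qhC.
  rewrite /Z !(rmorphM, rmorphD, rmorphB, rmorphXn, rmorph_sign) /=.
  by rewrite !castE; ring.
have ZdE : Z = (-1) ^+ b * (q * nu - n ^+ 2) + h * n by [].
clearbody Z.
have hC : (0 : algC) < h%:~R by rewrite ltr0z.
have qC : (0 : algC) < #|F|%:R by rewrite ltr0n card_finField_gt0.
apply: (@natz_dilated_bound _ _ #|null_pairs E|); rewrite -card_dilated_pairs_split //.
apply: (@even_dilated_bound _ h _ _ _ Z b) => //.
- exact: ltW.
- rewrite -(ler_int algC) -(ler_pM2l hC) mulr0 -NE.
  by rewrite mulr_ge0 // ltW.
- rewrite -(ler_int algC) -(ler_pM2l hC) -NE !rmorphM /= !castE.
  rewrite (_ : h%:~R * _ = #|F|%:R * (h%:~R ^+ 2 * #|E|%:R)); last by ring.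
  by rewrite ler_pM2l // -qhC.
- rewrite -(ler_int algC) -(ler_pM2l (exprn_gt0 2 hC)).
  rewrite !(rmorphM, rmorphD, rmorphN, rmorphXn) /= !castE.
  have NQ' := NQ; rewrite qhC -(ler_pM2l qC) in NQ'.
  have ZE : #|F|%:R * (#|F|%:R * N ^+ 2) = h%:~R ^+ 2 * Z%:~R ^+ 2.
    by rewrite -exprMn -NE; ring.
  rewrite ZE in NQ'.
  rewrite -subr_ge0 in NQ'; rewrite -subr_ge0.
  by apply: le_trans NQ' _; rewrite le_eqVlt; apply/orP; left; apply/eqP; ring.
Qed.

Lemma odd_nonnull_dilated_pairs (F : finFieldType) d (E : {set 'rV[F]_d}) (r : F) :
  odd #|F| -> odd d -> nonzero_square r -> (3 <= #|F|)%N -> (32 * #|F| ^ d <= #|E| ^ 2)%N ->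
  (3 * #|F| * #|E| ^ 4 <= 8 * #|F| ^ 2 * #|nonnull_dilated_pairs E r|)%N.
Proof.
move=> oddF odd_d sq_r q3 En; have [r0 _] := sq_r.
have [chi [chiD chi_conj chi0 chi1]] := additive_character F.
have nule := null_pairs_odd oddF chiD chi_conj chi0 chi1 E odd_d.
have gE w := gauss_prod_square oddF chiD chi0 chi1 d sq_r (w := w).
have := null_spectrum_sqr_le oddF chiD chi_conj chi0 chi1 E r0 gE.
have qC : (0 : algC) < #|F|%:R by rewrite ltr0n card_finField_gt0.
(* For odd d only the sign of q P^2 is used; dividing by q^d leaves n^4 <= q Q + q^d n^2. *)
have N0 : 0 <= #|F|%:R * null_spectrum chi E ^+ 2.
  by rewrite mulr_ge0 ?exprn_ge0 ?null_spectrum_ge0 // ltW.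
move/(le_trans N0).
rewrite exprMn expr2 -mulrA -mulrDr pmulr_rge0 ?exprn_gt0 // addrAC subr_ge0 => QE.
have dE : d = (d./2.*2).+1 by rewrite -[LHS]odd_double_half odd_d.
apply: (@natz_dilated_bound _ _ #|null_pairs E|); rewrite -card_dilated_pairs_split //.
have qd : (#|F| ^ d = #|F| * (#|F| ^ d./2) ^ 2)%N by rewrite [in LHS]dE expnS -expnM muln2.
apply: (@odd_dilated_bound _ (#|F| ^ d./2)%N) => //.
- by rewrite -!natz -!natrX -!natrM ler_nat -qd.
- by rewrite -!natz -!natrX -!natrM -natrD ler_nat -expnS -(ler_nat algC) natrD !natrM !natrX.
- rewrite -!natz -!natrX -!natrM -natrD ler_nat -qd -(ler_nat algC) natrD !natrM !natrX.
  exact: QE.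
Qed.

(** * Spheres, matchings and stars *)

Lemma card_sphere_le (F : finFieldType) d (t : F) :
  (#|[set z : 'rV[F]_d.+1 | sqnorm z == t]| <= 2 * #|F| ^ d)%N.
Proof.
(* Once the last d coordinates are fixed, the square of the first is determined. *)
pose tail (z : 'rV[F]_d.+1) := \row_(j < d) z 0 (lift ord0 j).
rewrite -sum1_card (partition_big tail predT) //= mulnC.
have -> : (#|F| ^ d = #|'rV[F]_d|)%N by rewrite card_mx mul1n.
rewrite -sum_nat_const; apply: leq_sum => w _.
have cE (z : 'rV[F]_d.+1) : sqnorm z = z 0 0 ^+ 2 + sqnorm (tail z).
  by rewrite /sqnorm big_ord_recl; congr (_ + _); apply: eq_bigr => i _; rewrite mxE.
rewrite sum1dep_card; apply: leq_trans (card_sqrt_le2 (t - sqnorm w)).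
rewrite -(card_in_imset (f := fun z : 'rV[F]_d.+1 => z 0 0)); last first.
  move=> z z'; rewrite !inE => /andP[_ /eqP zw] /andP[_ /eqP z'w] zz'.
  apply/rowP=> i; case: (unliftP ord0 i) => [j ->|-> //].
  by move: zw; rewrite -z'w => /rowP/(_ j); rewrite !mxE.
apply: subset_leq_card; apply/subsetP=> c /imsetP[z]; rewrite !inE => /andP[/eqP <- /eqP <-] ->.
by rewrite cE addrK.
Qed.

Lemma card_sphere_at_le (F : finFieldType) d (x : 'rV[F]_d) (t : F) : (0 < d)%N ->
  (#|[set u | sqdist (x, u) == t]| <= 2 * #|F| ^ d.-1)%N.
Proof.
case: d x => // d x _; apply: leq_trans (card_sphere_le d t).
rewrite -(card_imset (f := fun u => x - u)); last by move=> u v /addrI /oppr_inj.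
apply: subset_leq_card; apply/subsetP=> _ /imsetP[u uS ->].
by move: uS; rewrite !inE.
Qed.

(** Each chosen pair blocks at most 2 D pairs, those sharing a component with it, so a k-th pair is
    still free after k - 1 choices. *)
Lemma exists_matching (T : finType) (B : {set T * T}) (D k : nat) :
  (forall u, #|[set p in B | p.1 == u]| <= D)%N ->
  (forall v, #|[set p in B | p.2 == v]| <= D)%N ->
  ((k.-1 * (2 * D)) < #|B|)%N ->
  exists s : seq (T * T), [/\ size s = k, {subset s <= B},
    uniq (map fst s) & uniq (map snd s)].
Proof.
move=> D1 D2 kB.
have touch (s : seq (T * T)) :
    (#|[set p in B | (p.1 \in map fst s) || (p.2 \in map snd s)]| <= size s * (2 * D))%N.
  elim: s => [|[u v] s IH] /=.
    by rewrite leqn0 cards_eq0; apply/eqP/setP=> p; rewrite !inE andbF.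
  rewrite mulSn {1}mul2n -addnn.
  apply: leq_trans (leq_add (leq_add (D1 u) (D2 v)) IH).
  apply: leq_trans (leq_add (leq_card_setU _ _) (leqnn _)).
  apply: leq_trans (leq_card_setU _ _).
  apply: subset_leq_card; apply/subsetP=> p; rewrite !inE.
  by case: (p \in B) => //=; do !case: (_ == _); rewrite ?orbT //= orbC.
suff ex j : (j <= k)%N -> exists s : seq (T * T), [/\ size s = j, {subset s <= B},
    uniq (map fst s) & uniq (map snd s)] by apply: ex.
elim: j => [|j IH] jk; first by exists [::].
have [s [sj sB s1 s2]] := IH (ltnW jk).
have [p] : exists p, p \in B :\: [set p in B | (p.1 \in map fst s) || (p.2 \in map snd s)].
  apply/set0Pn; rewrite -card_gt0 cardsDS; last by apply/subsetP=> p; rewrite inE => /andP[].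
  rewrite subn_gt0; apply: leq_ltn_trans (touch s) _; apply: leq_ltn_trans kB.
  by rewrite leq_mul2r sj -ltnS prednK ?jk ?orbT //; apply: leq_trans jk.
rewrite !inE => /andP[pn pB]; move: pn; rewrite pB negb_or => /andP[p1 p2].
exists (p :: s); split=> /=; rewrite ?sj ?p1 ?p2 //.
by move=> x; rewrite inE => /predU1P[->|/sB].
Qed.

(** A matching of size k among these pairs of leaves is a pair of k-stars with centres [x] and
    [y]. *)
Definition star_edge_pairs (F : finFieldType) d (E : {set 'rV[F]_d}) (r : F) x y :=
  [set p in setX E E | (sqdist (y, p.2) == r * sqdist (x, p.1)) && (sqdist (x, p.1) != 0)].

Lemma nonnull_dilated_pairs_le (F : finFieldType) d (E : {set 'rV[F]_d}) (r : F) c :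
  (forall x y, x \in E -> y \in E -> #|star_edge_pairs E r x y| <= c)%N ->
  (#|nonnull_dilated_pairs E r| <= #|E| ^ 2 * c)%N.
Proof.
move=> Hc; pose centers (w : ('rV[F]_d * 'rV[F]_d) * ('rV[F]_d * 'rV[F]_d)) := (w.1.1, w.2.1).
rewrite -sum1_card (partition_big centers [in setX E E]) => [|w]; last first.
  by rewrite !inE => /andP[/andP[/andP[/andP[-> _] /andP[-> _]] _] _].
rewrite -mulnn -cardsX -sum_nat_const; apply: leq_sum => -[x y]; rewrite inE => /andP[xE yE].
apply: leq_trans (Hc x y xE yE); rewrite sum1dep_card.
pose leaves (w : ('rV[F]_d * 'rV[F]_d) * ('rV[F]_d * 'rV[F]_d)) := (w.1.2, w.2.2).
rewrite -(card_in_imset (f := leaves)).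
  apply: subset_leq_card; apply/subsetP=> _ /imsetP[[[x' u] [y' v]] + ->].
  rewrite !inE /= => /andP[/andP[/andP[/andP[/andP[_ ->] /andP[_ ->]] H1] H2] /eqP[<- <-]].
  by rewrite H1 H2.
move=> [[x1 u1] [y1 v1]] [[x2 u2] [y2 v2]]; rewrite !inE /=.
by move=> /andP[_ /eqP[-> ->]] /andP[_ /eqP[-> ->]] [-> ->].
Qed.

Lemma contains_star_pair (F : finFieldType) d (E : {set 'rV[F]_d}) (r : F) k x y :
  (0 < d)%N -> r != 0 -> x \in E -> y \in E ->
  (k.-1 * (2 * (2 * #|F| ^ d.-1)) < #|star_edge_pairs E r x y|)%N ->
  contains_pair (star_edge k) E r.
Proof.
move=> d0 r0 xE yE.
case/exists_matching=> [u|v|s [sk sB s1 s2]].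
- rewrite -(card_in_imset (f := snd)) => [|[u1 v1] [u2 v2]]; last first.
    by rewrite !inE /= => /andP[_ /eqP->] /andP[_ /eqP->] ->.
  apply: leq_trans (card_sphere_at_le y (r * sqdist (x, u)) d0).
  apply: subset_leq_card; apply/subsetP=> _ /imsetP[[u' v] + ->].
  by rewrite !inE /= => /andP[/andP[_ /andP[? _]] /eqP<-].
- rewrite -(card_in_imset (f := fst)) => [|[u1 v1] [u2 v2]]; last first.
    by rewrite !inE /= => /andP[_ /eqP->] /andP[_ /eqP->] ->.
  apply: leq_trans (card_sphere_at_le x (sqdist (y, v) / r) d0).
  apply: subset_leq_card; apply/subsetP=> _ /imsetP[[u v'] + ->].
  rewrite !inE /= => /andP[/andP[_ /andP[/eqP e _]] /eqP<-].
  by rewrite e mulrAC divff ?mul1r.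
have sP p : p \in s -> [/\ p.1 \in E, p.2 \in E, sqdist (y, p.2) = r * sqdist (x, p.1) &
    sqdist (x, p.1) != 0].
  by move/sB; rewrite !inE => /andP[/andP[-> ->] /andP[/eqP-> ->]].
have sq0 (z : 'rV[F]_d) : sqdist (z, z) = 0.
  by rewrite /sqdist subrr /sqnorm big1 // => i _; rewrite mxE expr0n.
(* No leaf equals its centre, because the distances are nonzero. *)
have u1 : uniq (x :: map fst s).
  rewrite /= s1 andbT; apply/mapP=> -[p /sP[_ _ _ p0] xp].
  by rewrite -xp sq0 eqxx in p0.
have u2 : uniq (y :: map snd s).
  rewrite /= s2 andbT; apply/mapP=> -[p /sP[_ _ pr p0] yp].
  by move: pr; rewrite -yp sq0 => /esym/eqP; rewrite mulf_eq0 (negPf r0) (negPf p0).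
(* Index 0 is the centre and leaf j sits at j + 1; both lists have length k + 1, so the default of
   [nth] is never reached. *)
pose X (i : 'I_k.+1) := nth x (x :: map fst s) i.
pose Y (i : 'I_k.+1) := nth y (y :: map snd s) i.
have mem_s (j : 'I_k) : nth (x, y) s j \in s by rewrite mem_nth ?sk.
have XE j : X (lift ord0 j) = (nth (x, y) s j).1.
  by rewrite /X lift0 /= (nth_map (x, y)) ?sk.
have YE j : Y (lift ord0 j) = (nth (x, y) s j).2.
  by rewrite /Y lift0 /= (nth_map (x, y)) ?sk.
have sqC (a b : 'rV[F]_d) : sqnorm (a - b) = sqnorm (b - a).
  by apply: eq_bigr => i _; rewrite !mxE -sqrrN opprB.
have edge0 j : sqnorm (Y ord0 - Y (lift ord0 j)) = r * sqnorm (X ord0 - X (lift ord0 j)) /\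
    sqnorm (X ord0 - X (lift ord0 j)) != 0.
  by rewrite XE YE; have [] := sP _ (mem_s j).
exists X, Y; split; [|split; [|split]].
- by move=> i j /eqP; rewrite nth_uniq //= ?size_map ?sk // => /eqP/val_inj.
- by move=> i j /eqP; rewrite nth_uniq //= ?size_map ?sk // => /eqP/val_inj.
- move=> i; case: (unliftP ord0 i) => [j ->|->]; last by split.
  by rewrite XE YE; have [] := sP _ (mem_s j).
- move=> i j; case: (unliftP ord0 i) => [i' ->|->]; case: (unliftP ord0 j) => [j' ->|->].
  + by rewrite /star_edge /= /bump !leq0n !add1n andbF.
  + by move=> _; rewrite sqC (sqC (X _)); apply: edge0.
  + by move=> _; apply: edge0.
  + by rewrite /star_edge eqxx.
Qed.

(** * From the count of quadruples to the theorem *)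

Lemma many_dilated_pairs_star (F : finFieldType) d (E : {set 'rV[F]_d}) (r : F) k :
  (0 < d)%N -> (2 <= k)%N -> r != 0 ->
  ((16 + 13 * 'C(k, 2) + 3 * 'C(k, 2) ^ 2) * #|F| ^ d <= #|E| ^ 2)%N ->
  (3 * #|F| * #|E| ^ 4 <= 8 * #|F| ^ 2 * #|nonnull_dilated_pairs E r|)%N ->
  contains_pair (star_edge k) E r.
Proof.
move=> d0 k2 r0 En HM; set c := (k.-1 * (2 * (2 * #|F| ^ d.-1)))%N.
have [/existsP[[x y] /and3P[xE yE Hxy]]|] :=
    boolP [exists p, [&& p.1 \in E, p.2 \in E & (c < #|star_edge_pairs E r p.1 p.2|)%N]].
  exact: contains_star_pair Hxy.
(* If every pair of centres has at most [c] edge pairs, the count gives 3 n^2 <= 32 (k - 1) q^d.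
   With b = 'C(k, 2) >= k - 1 this contradicts n^2 >= (16 + 13 b + 3 b^2) q^d. *)
rewrite negb_exists => /forallP few; exfalso.
have {few} /(leq_mul (leqnn (8 * #|F| ^ 2))) /(leq_trans HM) :
    (#|nonnull_dilated_pairs E r| <= #|E| ^ 2 * c)%N.
  apply: nonnull_dilated_pairs_le => x y xE yE.
  by have := few (x, y); rewrite /= xE yE /= -leqNgt.
have q0 := card_finField_gt0 F; have qd0 : (0 < #|F| ^ d)%N by rewrite expn_gt0 q0.
have n0 : (0 < #|E|)%N.
  by rewrite -(ltn_exp2r 0 _ (ltn0Sn 1)) exp0n //; apply: leq_trans En;
    rewrite muln_gt0 qd0 !addn_gt0.
have kb := pred_leq_bin2 k2.
rewrite (_ : 3 * #|F| * #|E| ^ 4 = #|F| * #|E| ^ 2 * (3 * #|E| ^ 2))%N; last by ring.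
rewrite (_ : 8 * #|F| ^ 2 * _ = #|F| * #|E| ^ 2 * (32 * k.-1 * #|F| ^ d))%N; last first.
  have -> : (#|F| ^ d = #|F| * #|F| ^ d.-1)%N by rewrite -expnS prednK.
  by rewrite /c; ring.
rewrite leq_pmul2l ?muln_gt0 ?q0 ?n0 //.
move=> H; have := leq_trans (leq_mul (leqnn 3) En) H.
rewrite mulnA leq_pmul2r //; lia.
Qed.

Theorem theorem1p5 (R : realType) (F : finFieldType) (d : nat)
    (E : {set 'rV[F]_d}) (k : nat) :
  odd #|F| -> (2 <= d)%N -> (2 <= k)%N ->
  ((5 <= #|F|)%N -> ~~ odd d -> forall r : F, r != 0 ->
     (#|E|%:R : R) >= (31 + 10 * (binomial k 2)%:R) * Num.sqrt ((#|F|%:R : R) ^+ d) ->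
     contains_pair (star_edge k) E r)
  /\
  ((3 <= d)%N -> odd d -> forall r : F, nonzero_square r ->
     (#|E|%:R : R) >= (4 + Num.sqrt 3 * (binomial k 2)%:R) * Num.sqrt ((#|F|%:R : R) ^+ d) ->
     contains_pair (star_edge k) E r).
Proof.
move=> oddF d2 k2; have d0 : (0 < d)%N by apply: ltnW.
have b1 : (1 <= 'C(k, 2))%N by rewrite bin_gt0.
split=> [q5 even_d r r0 En | d3 odd_d r sq_r En].
  have {}En : ((31 + 10 * 'C(k, 2)) * #|F| ^ d./2 <= #|E|)%N.
    rewrite -(ler_nat R) natrM natrD natrM natrX; apply: le_trans En.
    by rewrite -[in leRHS](even_halfK even_d) -muln2 exprM sqrtr_sqr ger0_norm ?exprn_ge0.
  apply: many_dilated_pairs_star => //.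
    apply: leq_trans (_ : ((31 + 10 * 'C(k, 2)) * #|F| ^ d./2) ^ 2 <= _)%N;
      last by rewrite leq_exp2r.
    rewrite expnMn -expnM muln2 even_halfK // leq_mul2r; apply/orP; right; nia.
  (* The factor 41 is the value of 31 + 10 'C(k, 2) at k = 2. *)
  apply: even_nonnull_dilated_pairs => //; apply: leq_trans En.
  by rewrite leq_mul2r; apply/orP; right; lia.
have [r0 _] := sq_r.
have {}En : ((16 + 13 * 'C(k, 2) + 3 * 'C(k, 2) ^ 2) * #|F| ^ d <= #|E| ^ 2)%N.
  (* In (4 + sqrt 3 b)^2 = 16 + 8 sqrt 3 b + 3 b^2 this bounds the middle coefficient below by
     13. *)
  have s3 : 13 / 8 <= Num.sqrt 3 :> R.
    rewrite -ler_sqr ?nnegrE ?sqrtr_ge0 ?divr_ge0 //. rewrite sqr_sqrtr //; lra.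
  have s32 : Num.sqrt 3 ^+ 2 = 3 :> R by rewrite sqr_sqrtr.
  have qd : Num.sqrt (#|F|%:R ^+ d) ^+ 2 = #|F|%:R ^+ d :> R by rewrite sqr_sqrtr ?exprn_ge0.
  rewrite -(ler_nat R) natrM !natrD !natrM !natrX.
  have := En; rewrite -ler_sqr ?nnegrE ?mulr_ge0 ?addr_ge0 ?mulr_ge0 ?sqrtr_ge0 //.
  apply: le_trans; rewrite exprMn qd ler_wpM2r ?exprn_ge0 //.
  have b0 : 0 <= 'C(k, 2)%:R :> R by [].
  by rewrite sqrrD exprMn s32; have := ler_wpM2r b0 s3; lra.
apply: many_dilated_pairs_star => //.
apply: odd_nonnull_dilated_pairs => //.
  have : (1 < #|F|)%N by apply/card_gt1P; exists 0, 1; rewrite eq_sym oner_eq0.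
  by case: #|F| oddF => [|[|[|]]].
(* At 'C(k, 2) = 1 the coefficient 16 + 13 + 3 is exactly the required 32. *)
apply: leq_trans En; rewrite leq_mul2r; apply/orP; right; nia.
Qed.
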